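(* Let $k\geq s\geq 1$ be fixed integers and let $p=p(n)\in(0,1)$ be a monotone function of $n$. If $\binom{n}{k+2}(1-p^{k+2})^{n-k-2}=o(n^s)$, then $\mathcal{N}[G(n,p)]$ is almost always $(k-s)$-connected, and almost always $\widetilde{H}^{k-s+1}(\mathcal{N}[G(n,p)])=0$.
   Context: $G(n,p)$ is the Erdős–Rényi random graph on $n$ vertices, each pair of distinct vertices being joined independently with probability $p$. A property holds almost always (a.a.) if its probability tends to $1$ as $n\to\infty$. The neighborhood complex $\mathcal{N}[G]$ of a graph $G=(V,E)$ is the simplicial complex whose faces are the subsets $\sigma\subseteq V$ having a common neighbor in $G$. A simplicial complex is $k$-connected if its geometric realization $\mathcal{X}$ has the property that every map $\mathbb{S}^i\to\mathcal{X}$ extends to a map $\mathbb{B}^{i+1}\to\mathcal{X}$ for $i=0,1,\ldots,k$. $\widetilde{H}^{m}(\cdot)$ denotes the $m$-th reduced cohomology group with integer coefficients. *)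

(* Defs.v *)
From HB Require Import structures.
From mathcomp Require Import all_boot all_order all_algebra.
From mathcomp Require Import ring_quotient.
From mathcomp Require Import all_classical all_reals all_analysis.

Set Implicit Arguments.
Unset Strict Implicit.
Unset Printing Implicit Defensive.

Import Order.TTheory GRing.Theory Num.Theory.
Import numFieldNormedType.Exports.

Local Open Scope classical_set_scope.
Local Open Scope ring_scope.

(* A simple graph on the vertex set 'I_n is its set of edges. *)
Definition sgraph (n : nat) :=
  {E : {set {set 'I_n}} | [forall e in E, #|e| == 2%N]}.

(* Irreflexive, since [set u; u] has a single element. *)
Definition adj (n : nat) (G : sgraph n) : rel 'I_n :=
  fun u v => [set u; v]%SET \in val G.

Definition gnp_weight (R : realType) (n : nat) (p : R) (G : sgraph n) : R :=
  \prod_(e : {set 'I_n} | #|e| == 2%N) (if e \in val G then p else 1 - p).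

Definition gnp_prob (R : realType) (n : nat) (p : R) (A : sgraph n -> Prop) : R :=
  \sum_(G : sgraph n | `[< A G >]) gnp_weight p G.

Definition almost_always (R : realType) (p : nat -> R)
    (A : forall n, sgraph n -> Prop) : Prop :=
  gnp_prob (p n) (@A n) @[n --> \oo] --> (1 : R).

(* The empty set counts as a face. *)
Record complex (n : nat) := Complex {
  faces :> {set {set 'I_n}};
  faces_down : forall s t : {set 'I_n}, s \in faces -> t \subset s -> t \in faces
}.

Definition nbhd_faces (n : nat) (G : sgraph n) : {set {set 'I_n}} :=
  [set s : {set 'I_n} | [exists w, [forall v in s, adj G v w]]]%SET.

Lemma nbhd_faces_down (n : nat) (G : sgraph n) (s t : {set 'I_n}) :
  s \in nbhd_faces G -> t \subset s -> t \in nbhd_faces G.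
Proof.
rewrite !inE => /existsP[w /forall_inP sw] /fintype.subsetP ts.
by apply/existsP; exists w; apply/forall_inP => v /ts; apply: sw.
Qed.

Definition nbhd_complex (n : nat) (G : sgraph n) : complex n :=
  Complex (@nbhd_faces_down n G).

(* Barycentric coordinates, in R^n with one coordinate per vertex. *)
Definition realization (R : realType) (n : nat) (K : complex n) : set 'rV[R]_n :=
  [set x | [/\ forall v, 0 <= x ord0 v,
               \sum_v x ord0 v = 1 &
               [set v | x ord0 v != 0]%SET \in faces K]].
Arguments realization R {n} K.

(* S^i in R^(i+1); the topology of 'rV[R]_m is the product one, so only the
   defining equation has to use the Euclidean norm. *)
Definition sphere (R : realType) (i : nat) : set 'rV[R]_i.+1 :=
  [set x | \sum_j x ord0 j ^+ 2 = 1].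
Arguments sphere R i : clear implicits.

(* The closed ball B^m in R^m. *)
Definition cball (R : realType) (m : nat) : set 'rV[R]_m :=
  [set x | \sum_j x ord0 j ^+ 2 <= 1].
Arguments cball R m : clear implicits.

(* Maps out of a subspace are total functions, constrained on it only. *)
Definition kconnected_space (R : realType) (T : topologicalType)
    (X : set T) (k : nat) : Prop :=
  forall i : nat, (i <= k)%N ->
  forall f : 'rV[R]_i.+1 -> T,
    {within sphere R i, continuous f} -> f @` sphere R i `<=` X ->
  exists g : 'rV[R]_i.+1 -> T,
    [/\ {within cball R i.+1, continuous g},
        g @` cball R i.+1 `<=` X &
        forall x, sphere R i x -> g x = f x].
Arguments kconnected_space R {T} X k.

Definition kconnected (R : realType) (n : nat) (K : complex n) (k : nat) : Prop :=
  kconnected_space R (realization R K) k.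
Arguments kconnected R {n} K k.

Section Cohomology.
Variables (n : nat) (K : complex n).

(* Faces and cochains are indexed by the number of vertices: dimension + 1.
   Index 0 is the empty face, which is what makes the cohomology reduced. *)
Definition kface (c : nat) := {s : {set 'I_n} | (s \in faces K) && (#|s| == c)}.
Definition cochain (c : nat) := {ffun kface c -> int}.

(* The exponent is the position of v in s, listed increasingly.  The insub
   never fails here: s :\ v is a face with c vertices. *)
Definition coboundary (c : nat) (f : cochain c) : cochain c.+1 :=
  [ffun s : kface c.+1 => \sum_(v in val s)
     (-1) ^+ #|[set u in val s | (u < v)%N]%SET| *
     oapp f 0 (insub (val s :\ v)%SET : option (kface c))].

Fact coboundary_is_zmod_morphism (c : nat) : zmod_morphism (@coboundary c).
Proof.
move=> f g; apply/ffunP => s; rewrite !ffunE -sumrB; apply: eq_bigr => v _.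
by rewrite -mulrBr; congr (_ * _); case: insub => [t|] /=; rewrite ?ffunE ?subrr.
Qed.

HB.instance Definition _ (c : nat) :=
  GRing.isZmodMorphism.Build (cochain c) (cochain c.+1) (@coboundary c)
    (@coboundary_is_zmod_morphism c).

Definition is_cocycle (c : nat) : {pred cochain c} :=
  fun f => coboundary f == 0.

Fact is_cocycle_closed (c : nat) : zmod_closed (@is_cocycle c).
Proof.
split=> [|f g]; rewrite !unfold_in /is_cocycle ?raddf0 //.
by move=> /eqP f0 /eqP g0; rewrite raddfB /= f0 g0 subrr.
Qed.

HB.instance Definition _ (c : nat) :=
  GRing.isZmodClosed.Build (cochain c) (@is_cocycle c) (@is_cocycle_closed c).

Record cocycle (c : nat) :=
  Cocycle { cocycle_val :> cochain c; _ : cocycle_val \in @is_cocycle c }.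
HB.instance Definition _ (c : nat) := [isSub for @cocycle_val c].
HB.instance Definition _ (c : nat) := [Choice of cocycle c by <:].
HB.instance Definition _ (c : nat) :=
  [SubChoice_isSubZmodule of cocycle c by <:].

Definition is_coboundary (c : nat) : {pred cocycle c.+1} :=
  fun z => `[< exists b : cochain c, coboundary b = val z >].

Fact is_coboundary_closed (c : nat) : zmod_closed (@is_coboundary c).
Proof.
split=> [|y z]; first by apply/asboolP; exists 0; rewrite !raddf0.
move=> /asboolP[a ay] /asboolP[b bz]; apply/asboolP.
by exists (a - b); rewrite !raddfB /= ay bz.
Qed.

HB.instance Definition _ (c : nat) :=
  GRing.isZmodClosed.Build (cocycle c.+1) (@is_coboundary c)
    (@is_coboundary_closed c).

(* The m-th reduced cohomology group with integer coefficients. *)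
Definition redcohomology (m : nat) : zmodType :=
  Quotient.quot (@is_coboundary m).

End Cohomology.

(* Main.v *)
(* Call v an apex if every set of at most k - s + 3 vertices containing v is a
   face.  If there is no apex, every vertex v lies in a missing set of size
   k - s + 3, hence in about n^(s-1) missing sets of size k + 2, so that there are
   at least c n^s missing sets of size k + 2.  Their expected number is
   C(n, k+2) (1 - p^(k+2))^(n-k-2) = o(n^s), so by Markov's inequality an apex
   exists almost always.

   Coning off the apex kills the cohomology in degree k - s + 1.  For the
   connectivity it suffices that all sets of k - s + 2 vertices are faces: a map
   f on S^i, i <= k - s, is extended radially to an annulus and there deformed,
   inside the faces carrying its values, to a map h which is defined on the whole
   ball and sends each simplex of a fine triangulation of R^(i+1) to a simplex.
   As h takes values in simplices with at most i + 2 vertices, it maps the ball to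
   the complex. *)

Require Import Defs.
From mathcomp Require Import all_boot all_order all_algebra.
From mathcomp Require Import all_classical all_reals all_analysis.
From mathcomp Require Import ring lra zify.
From mathcomp Require Import ring_quotient.

Import Order.TTheory GRing.Theory Num.Theory.
Import numFieldNormedType.Exports.

Local Open Scope classical_set_scope.
Local Open Scope ring_scope.

Set Implicit Arguments.
Unset Strict Implicit.
Unset Printing Implicit Defensive.

(** * Missing faces and apices *)

Lemma cardsU_subsetC (T : finType) (A B : {set T}) :
  B \subset (~: A)%SET -> #|(A :|: B)%SET| = (#|A| + #|B|)%N.
Proof.
rewrite -finset.disjoints_subset disjoint_sym -finset.setI_eq0 => /eqP AB.
by rewrite cardsU AB cards0 subn0.
Qed.

Lemma exists_superset_card (T : finType) (A : {set T}) (b : nat) :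
  (#|A| <= b <= #|T|)%N -> exists2 B : {set T}, A \subset B & #|B| = b.
Proof.
move=> /andP[Ab bT].
have : (0 < #|[set B : {set T} | B \subset ~: A & #|B| == b - #|A|]|)%N.
  by rewrite cards_draws bin_gt0 -(leq_add2l #|A|) cardsC subnKC.
case/card_gt0P => B; rewrite inE => /andP[BA /eqP Bb].
exists (A :|: B)%SET; first exact: finset.subsetUl.
by rewrite cardsU_subsetC // Bb subnKC.
Qed.

(** The sets counted are the [A :|: B] with [B] in the complement of [A], and [B] is recovered by
    removing [A]. *)
Lemma leq_bin_supersets (T : finType) (A : {set T}) (P : pred {set T}) (c : nat) :
  (forall B : {set T}, A \subset B -> P B) -> (#|A| <= c)%N ->
  ('C(#|T| - #|A|, c - #|A|) <=
   #|[set B : {set T} | (A \subset B) && ((#|B| == c) && P B)]%SET|)%N.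
Proof.
move=> AP Ac; have <- : #|(~: A)%SET| = (#|T| - #|A|)%N.
  by rewrite -(cardsC A) addKn.
rewrite -cards_draws -(card_in_imset (f := fun B => A :|: B)%SET).
  apply/subset_leq_card/fintype.subsetP => _ /imsetP[B + ->].
  rewrite !inE => /andP[BA /eqP Bc].
  rewrite finset.subsetUl AP ?finset.subsetUl // andbT /=.
  by rewrite cardsU_subsetC // Bc subnKC.
move=> B C; rewrite !inE => /andP[BA _] /andP[CA _].
move=> /(congr1 (fun D : {set T} => D :\: A)%SET).
rewrite !finset.setDUl !finset.setDv !finset.set0U.
move: BA CA; rewrite -!finset.disjoints_subset.
by move=> /finset.setDidPl -> /finset.setDidPl ->.
Qed.

Lemma leq_expn_ffact (m t j : nat) : (j <= t)%N -> ((m - t) ^ j <= m ^_ j)%N.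
Proof.
elim: j => // j IH jt; rewrite expnSr ffactnSr.
exact: leq_mul (IH (ltnW jt)) (leq_sub2l _ (ltnW jt)).
Qed.

(** The hypothesis gives [n <= 2 * (n - b - t)], so each of the [t] factors of the falling factorial
    of [n - b] is at least [n / 2]. *)
Lemma leq_expn_bin (n b t : nat) : (2 * (b + t) <= n)%N ->
  (n ^ t <= 2 ^ t * t`! * 'C(n - b, t))%N.
Proof.
move=> nbt; rewrite -mulnA (mulnC t`!) bin_ffact.
apply: leq_trans (leq_mul (leqnn _) (leq_expn_ffact (n - b) (leqnn t))).
by rewrite -expnMn; case: t nbt => // t nbt; rewrite leq_exp2r //; lia.
Qed.

Section Apex.
Variables (n : nat) (K : complex n).

Definition missing (c : nat) : {set {set 'I_n}} :=
  [set t : {set 'I_n} | (#|t| == c) && (t \notin faces K)]%SET.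

(* Double counting of the pairs (v, w) with v in a missing set w of size c: all
   supersets of the missing set attached to v are missing. *)
Lemma leq_apexless_missing (b c : nat) : (b <= c)%N -> (b <= n)%N ->
  (forall v : 'I_n, exists t : {set 'I_n},
     [/\ v \in t, (#|t| <= b)%N & t \notin faces K]) ->
  (n * 'C(n - b, c - b) <= c * #|missing c|)%N.
Proof.
move=> bc bn noapex.
have -> : (c * #|missing c| = \sum_v #|[set t in missing c | v \in t]%SET|)%N.
  rewrite (eq_bigr (fun v => \sum_(t in missing c) (v \in t))%N); last first.
    move=> v _; rewrite -sum1_card big_mkcond [RHS]big_mkcond.
    apply: eq_bigr => t _; rewrite !inE.
    by case: (v \in t); rewrite ?andbT ?andbF //; case: ifP.
  rewrite exchange_big /= mulnC -sum_nat_const; apply: eq_bigr => t.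
  rewrite inE => /andP[/eqP <- _]; rewrite -sum1_card big_mkcond.
  by apply: eq_bigr => v _; case: (v \in t).
rewrite -[n in (n * _)%N]card_ord -sum_nat_const; apply: leq_sum => v _.
have [t [vt tb tNK]] := noapex v.
(* Enlarging [t] to exactly [b] elements makes one binomial coefficient serve for every [v]. *)
have [u tu ub] : exists2 u : {set 'I_n}, t \subset u & #|u| = b.
  by apply: exists_superset_card; rewrite tb card_ord.
have uNK (w : {set 'I_n}) : u \subset w -> (v \in w) && (w \notin faces K).
  move=> uw; rewrite (fintype.subsetP uw) ?(fintype.subsetP tu) //=.
  by apply: contra tNK => /faces_down; apply; apply: fintype.subset_trans uw.
have := @leq_bin_supersets _ u _ c uNK.
rewrite ub card_ord => /(_ bc)/leq_trans; apply; apply/subset_leq_card.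
by apply/fintype.subsetP => w; rewrite !inE => /and4P[_ -> -> ->].
Qed.

(** Without an apex the double count applies. Its binomial coefficient is of order [n ^ (c - b)],
    and the choice of the vertex gives one more factor [n]. *)
Lemma apex_or_many_missing (b c : nat) : (b <= c)%N -> (2 * c <= n)%N ->
  (exists v : 'I_n, forall t : {set 'I_n},
     v \in t -> (#|t| <= b)%N -> t \in faces K) \/
  (n ^ (c - b).+1 <= 2 ^ (c - b) * (c - b)`! * c * #|missing c|)%N.
Proof.
move=> bc cn; have [|noapex] := pselect (exists v : 'I_n, forall t : {set 'I_n},
  v \in t -> (#|t| <= b)%N -> t \in faces K); [by left|right].
rewrite expnS -mulnA.
have /leq_expn_bin nb : (2 * (b + (c - b)) <= n)%N by rewrite subnKC.
apply: leq_trans (leq_mul (leqnn n) nb) _.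
rewrite mulnCA leq_mul2l leq_apexless_missing ?orbT //; first by lia.
move=> v; apply: contrapT => vapex; apply: noapex; exists v => t vt tb.
by apply: contrapT => tNK; apply: vapex; exists t; split => //; apply/negP.
Qed.

End Apex.

(** * First moment in G(n, p) *)

Section Gnp.
Variables (R : realType) (n : nat) (p : R).
Implicit Types (G : sgraph n).

Lemma card_edge (G : sgraph n) (e : {set 'I_n}) : e \in val G -> #|e| = 2%N.
Proof. by move=> eG; have /forall_inP/(_ _ eG)/eqP := valP G. Qed.

Lemma sum_sgraph (F : {set {set 'I_n}} -> R) :
  \sum_(G : sgraph n) F (val G) =
  \sum_(E : {set {set 'I_n}} | [forall e in E, #|e| == 2%N]) F E.
Proof.
exact: esym (big_sub
  [pred E : {set {set 'I_n}} | [forall e in E, #|e| == 2%N]] F).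
Qed.

Lemma gnp_sum_supgraphs (S : {set {set 'I_n}}) :
  (forall e : {set 'I_n}, e \in S -> #|e| = 2%N) ->
  \sum_(G : sgraph n) (S \subset val G)%:R * gnp_weight p G = p ^+ #|S|.
Proof.
move=> S2; rewrite /gnp_weight.
(* [F e] and [H e] are the factors for [e] in and outside [E]. Their zeros remove each [E] that
   contains a non-pair or omits an element of [S], so the sum runs over all [E] and factors over
   [e]. *)
pose F (e : {set 'I_n}) : R := if #|e| == 2%N then p else 0.
pose H (e : {set 'I_n}) : R :=
  if #|e| == 2%N then (if e \in S then 0 else 1 - p) else 1.
rewrite (sum_sgraph (fun E => (S \subset E)%:R *
  \prod_(e : {set 'I_n} | #|e| == 2%N) (if e \in E then p else 1 - p))).
transitivity (\sum_(E : {set {set 'I_n}})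
    \prod_e (if e \in E then F e else H e)); last first.
  rewrite -bigA_distr -prodr_const [RHS]big_mkcond /=; apply: eq_bigr => e _.
  rewrite /F /H; have [eS|eS] := boolP (e \in S).
    by rewrite S2 // eqxx addr0.
  by case: ifP => _; rewrite ?add0r //; ring.
rewrite big_mkcond; apply: eq_bigr => E _.
have [E2|E2] := boolP [forall e in E, #|e| == 2%N]; last first.
  move: E2; rewrite negb_forall => /existsP[e].
  rewrite negb_imply => /andP[eE e2].
  by rewrite [RHS](bigD1 e) //= eE /F (negbTE e2) mul0r.
have [SE|/subsetPn[e eS eE]] := boolP (S \subset E); last first.
  by rewrite mul0r [RHS](bigD1 e) //= (negbTE eE) /H S2 // eqxx eS mul0r.
rewrite mul1r big_mkcond; apply: eq_bigr => e _.
have [eE|eE] := boolP (e \in E).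
  by rewrite /F (eqP (forall_inP E2 _ eE)).
rewrite /H; have [eS|//] := boolP (e \in S).
by rewrite (fintype.subsetP SE) in eE.
Qed.

Lemma gnp_weight_sum1 : \sum_(G : sgraph n) gnp_weight p G = 1.
Proof.
have := @gnp_sum_supgraphs finset.set0; rewrite cards0 expr0 => <-.
  by apply: eq_bigr => G _; rewrite finset.sub0set mul1r.
by move=> e; rewrite inE.
Qed.

(* Inclusion-exclusion over the vertices w outside t: distinct pairs (v, w) with
   v in t give distinct edges, so |U| of them are all common neighbours of t
   with probability p^(|t||U|). *)
Lemma gnp_sum_not_nbhd_face (t : {set 'I_n}) :
  \sum_(G : sgraph n) (t \notin nbhd_faces G)%:R * gnp_weight p G =
  (1 - p ^+ #|t|) ^+ (n - #|t|).
Proof.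
pose nb G w := [forall v in t, adj G v w].
pose F G w : R := if w \in t then 0 else - (nb G w)%:R.
pose f w : R := if w \in t then 0 else - p ^+ #|t|.
(* The indicator is the product of [1 - nb G w] over [w] outside [t]: adjacency is irreflexive, so
   no vertex of [t] is a common neighbour of [t]. *)
have notfaceE G : (t \notin nbhd_faces G)%:R =
    \sum_(U : {set 'I_n}) \prod_w (if w \in U then F G w else 1).
  rewrite -bigA_distr /F inE; have [/existsP[w tw]|] := boolP [exists w, nb G w].
    have wt : (w \in t) = false.
      apply/negP => wt; have /card_edge := forall_inP tw _ wt.
      by rewrite finset.setUid cards1.
    by rewrite (bigD1 w isT) /= wt tw addNr mul0r.
  rewrite negb_exists => /forallP noface; rewrite big1 // => w _.
  by case: ifP => _ /=; rewrite ?add0r // (negbTE (noface w)) oppr0 add0r.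
have fE : (1 - p ^+ #|t|) ^+ (n - #|t|) =
    \sum_(U : {set 'I_n}) \prod_w (if w \in U then f w else 1).
  rewrite -bigA_distr.
  have <- : #|(~: t)%SET| = (n - #|t|)%N.
    by have := cardsC t; rewrite card_ord; lia.
  rewrite -prodr_const big_mkcond; apply: eq_bigr => w _; rewrite inE /f.
  by case: (w \in t) => /=; rewrite ?add0r // addrC.
rewrite fE (eq_bigr (fun G => \sum_(U : {set 'I_n})
    (\prod_w (if w \in U then F G w else 1)) * gnp_weight p G)); last first.
  by move=> G _; rewrite notfaceE big_distrl.
rewrite exchange_big; apply: eq_bigr => U _ /=.
have [UT|/subsetPn[w wU]] := boolP (U \subset ~: t)%SET; last first.
  rewrite inE negbK => wt; rewrite big1; last first.
    by move=> G _; rewrite (bigD1 w) //= wU /F wt !mul0r.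
  by rewrite (bigD1 w) //= wU /f wt mul0r.
have tNU w : w \in U -> (w \in t) = false.
  by move=> /(fintype.subsetP UT); rewrite inE => /negbTE.
pose edge (vw : 'I_n * 'I_n) := [set vw.1; vw.2]%SET.
pose S := (edge @: finset.setX t U)%SET.
(* As [t] and [U] are disjoint, an edge determines which of its ends lies in [t]. *)
have edge_inj : {in finset.setX t U &, injective edge}.
  move=> [v w] [v' w'] /setXP[/= vt wU] /setXP[/= v't w'U] /finset.setP vw.
  have vE : v = v'.
    have := vw v; rewrite !inE eqxx /= => /esym/orP[/eqP //|/eqP vw'].
    by rewrite vw' tNU in vt.
  have wE : w = w'.
    have := vw w; rewrite !inE eqxx orbT /= => /esym/orP[/eqP wv'|/eqP //].
    by rewrite -wv' tNU in v't.
  by rewrite vE wE.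
have S2 (e : {set 'I_n}) : e \in S -> #|e| = 2%N.
  move=> /imsetP[[v w] /setXP[/= vt wU] ->]; rewrite cards2 /=.
  by case: (v =P w) => // vw; rewrite vw tNU in vt.
(* The product over [U] is [(-1) ^+ #|U|] if all pairs between [t] and [U] are edges, and 0
   otherwise. *)
transitivity (\sum_(G : sgraph n)
    (-1) ^+ #|U| * ((S \subset val G)%:R * gnp_weight p G)).
  apply: eq_bigr => G _; rewrite mulrA; congr (_ * _).
  have [SG|/subsetPn[_ /imsetP[[v w] /setXP[/= vt wU] ->] vwG]] :=
    boolP (S \subset val G).
    rewrite mulr1 -prodr_const [RHS]big_mkcond; apply: eq_bigr => w _.
    case: ifP => // wU; rewrite /F tNU // (_ : nb G w = true) //.
    apply/forall_inP => v vt; apply: (fintype.subsetP SG).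
    by apply/imsetP; exists (v, w) => //; apply/setXP.
  rewrite (bigD1 w) //= wU /F tNU // (_ : nb G w = false) ?oppr0 ?mul0r ?mulr0 //.
  by apply/negbTE/forall_inPn; exists v.
rewrite -big_distrr /= gnp_sum_supgraphs // card_in_imset // cardsX exprM.
rewrite -exprMn mulN1r -[LHS]prodr_const big_mkcond; apply: eq_bigr => w _.
by case: ifP => // wU; rewrite /f tNU.
Qed.

Lemma gnp_expected_missing (c : nat) :
  \sum_(G : sgraph n) (#|missing (nbhd_complex G) c|)%:R * gnp_weight p G =
  ('C(n, c))%:R * (1 - p ^+ c) ^+ (n - c).
Proof.
have cardE G : (#|missing (nbhd_complex G) c|)%:R =
    \sum_(t : {set 'I_n} | #|t| == c) (t \notin nbhd_faces G)%:R :> R.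
  rewrite -sum1_card natr_sum big_mkcond [RHS]big_mkcond /=.
  apply: eq_bigr => t _; rewrite inE /=; case: (#|t| == c) => //=.
  by case: (t \in nbhd_faces G).
rewrite (eq_bigr (fun G => \sum_(t : {set 'I_n} | #|t| == c)
    (t \notin nbhd_faces G)%:R * gnp_weight p G)); last first.
  by move=> G _; rewrite cardE big_distrl.
rewrite exchange_big /=.
rewrite (eq_bigr (fun=> (1 - p ^+ c) ^+ (n - c))); last first.
  by move=> t /eqP tc; rewrite gnp_sum_not_nbhd_face tc.
rewrite sumr_const -[LHS]mulr_natl; congr (_%:R * _).
rewrite -[in RHS](card_ord n) -cardsT -cards_draws.
by apply: eq_card => t; rewrite !inE finset.subsetT.
Qed.

Hypothesis p01 : 0 <= p <= 1.

Lemma gnp_weight_ge0 G : 0 <= gnp_weight p G.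
Proof.
have /andP[p0 p1] := p01.
by apply: prodr_ge0 => e _; case: ifP; rewrite ?subr_ge0.
Qed.

Lemma gnp_prob_le1 (A : sgraph n -> Prop) : gnp_prob p A <= 1.
Proof.
rewrite /gnp_prob -gnp_weight_sum1 [leLHS]big_mkcond; apply: ler_sum => G _.
by case: ifP => // _; exact: gnp_weight_ge0.
Qed.

Lemma le_gnp_prob (A B : sgraph n -> Prop) :
  (forall G, A G -> B G) -> gnp_prob p A <= gnp_prob p B.
Proof.
move=> AB; rewrite /gnp_prob big_mkcond [leRHS]big_mkcond; apply: ler_sum => G _.
case: asboolP => [/AB BG|_]; first by rewrite (asboolT BG).
by case: ifP => // _; exact: gnp_weight_ge0.
Qed.

(** Pointwise, the indicator of [A] plus [F] is at least 1; the bound follows by taking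
    expectations. *)
Lemma gnp_markov (A : sgraph n -> Prop) (F : sgraph n -> R) :
  (forall G, 0 <= F G) -> (forall G, A G \/ 1 <= F G) ->
  1 - \sum_(G : sgraph n) F G * gnp_weight p G <= gnp_prob p A.
Proof.
move=> F0 AF; rewrite lerBlDr -gnp_weight_sum1 /gnp_prob.
rewrite [X in _ <= X + _]big_mkcond -big_split /=; apply: ler_sum => G _.
have w0 := gnp_weight_ge0 G; have [AG|F1] := AF G.
  by rewrite (asboolT AG) lerDl mulr_ge0.
case: ifP => _; first by rewrite lerDl mulr_ge0.
by rewrite add0r ler_peMl.
Qed.

End Gnp.

(** * Almost sure existence of an apex in the limit *)

Section AlmostAlways.
Variables (R : realType) (p : nat -> R).
Hypothesis p01 : forall n, 0 <= p n <= 1.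

Lemma almost_always_imply (A B : forall n, sgraph n -> Prop) :
  (forall n (G : sgraph n), A n G -> B n G) ->
  almost_always p A -> almost_always p B.
Proof.
move=> AB /cvgrPdist_le cvgA; apply/cvgrPdist_le => e e0.
apply: filterS (cvgA e e0) => n; rewrite !ger0_norm ?subr_ge0 ?gnp_prob_le1 //.
by apply: le_trans; rewrite lerB // le_gnp_prob //; exact: AB.
Qed.

Lemma almost_always_apex (b c : nat) : (b <= c)%N ->
  (fun n : nat => ('C(n, c))%:R * (1 - p n ^+ c) ^+ (n - c) : R^o)
    =o_\oo (fun n : nat => n%:R ^+ (c - b).+1 : R^o) ->
  almost_always p (fun n (G : sgraph n) => exists v : 'I_n,
    forall t : {set 'I_n}, v \in t -> (#|t| <= b)%N -> t \in nbhd_faces G).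
Proof.
move=> bc smallo; set s := (c - b).+1.
pose M : R := (2 ^ (c - b) * (c - b)`! * c)%:R.
apply/cvgrPdist_le => e e0.
(* [M] can be 0, hence the denominator [M + 1]; the final bound is [M * (e / (M + 1)) <= e]. *)
have M1 : 0 < M + 1 by rewrite ltr_wpDl.
have eM : 0 < e / (M + 1) by rewrite divr_gt0.
have /eqoP/(_ _ eM) small := smallo.
near=> n.
have n0 : (0 < n)%N by near: n; exists 1%N.
have cn : (2 * c <= n)%N by near: n; exists (2 * c)%N.
have ns0 : 0 < n%:R ^+ s :> R by rewrite exprn_gt0 // ltr0n.
rewrite ger0_norm ?subr_ge0 ?gnp_prob_le1 //.
(* Scaled so that [F G >= 1] whenever [G] has no apex. *)
pose F (G : sgraph n) : R := M / n%:R ^+ s * (#|missing (nbhd_complex G) c|)%:R.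
have F0 G : 0 <= F G by rewrite !mulr_ge0 // invr_ge0 ltW.
rewrite lerBlDr -lerBlDl; apply: le_trans (gnp_markov (p01 n) F0 _); last first.
  move=> G; have [|many] := apex_or_many_missing (nbhd_complex G) bc cn;
    [by left|right].
  rewrite /F mulrAC ler_pdivlMr // mul1r /M.
  by rewrite -natrX -natrM ler_nat.
rewrite lerB // /F (eq_bigr (fun G => M / n%:R ^+ s *
  ((#|missing (nbhd_complex G) c|)%:R * gnp_weight (p n) G))); last first.
  by move=> G _; rewrite mulrA.
rewrite -big_distrr /= gnp_expected_missing.
have : `|('C(n, c))%:R * (1 - p n ^+ c) ^+ (n - c)| <= e / (M + 1) * `|n%:R ^+ s : R|.
  by near: n; exact: small.
rewrite (ger0_norm (ltW ns0)) => /(le_trans (ler_norm _)) le_e.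
rewrite mulrAC ler_pdivrMr //.
apply: le_trans (ler_wpM2l (ler0n _ _) le_e) _.
rewrite mulrA ler_wpM2r ?(ltW ns0) // -/M.
by rewrite mulrCA ler_piMr ?(ltW e0) // ler_pdivrMr // mul1r lerDl.
Unshelve. all: by end_near. Qed.

End AlmostAlways.

(** * Cohomology of a complex with an apex *)

Section ConeCohomology.
Variables (n : nat) (K : complex n).

(** Extension by 0 to all vertex sets, which frees the sign computations from proofs of being a
    face. *)
Definition cochain_ext (c : nat) (f : cochain K c) (t : {set 'I_n}) : int :=
  oapp f 0 (insub t : option (kface K c)).

Definition pos_in (t : {set 'I_n}) (u : 'I_n) : nat :=
  #|[set w in t | (w < u)%N]%SET|.

Lemma cochain_ext_val (c : nat) (f : cochain K c) (t : kface K c) :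
  cochain_ext f (val t) = f t.
Proof. by rewrite /cochain_ext valK. Qed.

Lemma coboundaryE (c : nat) (f : cochain K c) (t : kface K c.+1) :
  coboundary f t =
  \sum_(u in val t) (-1) ^+ pos_in (val t) u * cochain_ext f (val t :\ u)%SET.
Proof. by rewrite ffunE. Qed.

Lemma pos_in_setD1_self (t : {set 'I_n}) (v : 'I_n) :
  pos_in (t :\ v)%SET v = pos_in t v.
Proof.
rewrite /pos_in; apply: eq_card => w; rewrite !inE.
by case: eqP => [->|] //=; rewrite ltnn andbF.
Qed.

Lemma pos_in_setU1_self (t : {set 'I_n}) (v : 'I_n) :
  pos_in (v |: t)%SET v = pos_in t v.
Proof.
rewrite /pos_in; apply: eq_card => w; rewrite !inE.
by case: eqP => [->|] //=; rewrite ltnn andbF.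
Qed.

Lemma pos_in_setD1 (t : {set 'I_n}) (u v : 'I_n) :
  u \in t -> pos_in t v = ((u < v) + pos_in (t :\ u)%SET v)%N.
Proof.
move=> ut; rewrite /pos_in (cardsD1 u) !inE ut /=; congr (_ + _)%N.
by apply: eq_card => w; rewrite !inE; case: (w == u).
Qed.

(* An apex v turns a cocycle z into the coboundary of the cochain
   s |-> z (v |: s), up to sign and extended by 0 on the faces through v. *)
Lemma cone_cocycle_exact (v : 'I_n) (m : nat) (z : cochain K m.+1) :
  (forall t : {set 'I_n}, v \in t -> (#|t| <= m.+2)%N -> t \in faces K) ->
  coboundary z = 0 -> exists b : cochain K m, coboundary b = z.
Proof.
move=> apex dz.
pose b : cochain K m := [ffun t : kface K m => if v \in val t then 0 else
  (-1) ^+ pos_in (val t) v * cochain_ext z (v |: val t)%SET].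
have bE (t : {set 'I_n}) : t \in faces K -> #|t| = m -> cochain_ext b t =
    if v \in t then 0 else (-1) ^+ pos_in t v * cochain_ext z (v |: t)%SET.
  move=> tK tm; have tP : (t \in faces K) && (#|t| == m) by rewrite tK tm eqxx.
  transitivity (b (exist _ t tP)); last by rewrite ffunE.
  exact: cochain_ext_val b (exist _ t tP).
exists b; apply/ffunP => -[t tP]; rewrite coboundaryE /=.
have /andP[tK /eqP tm] := tP.
have cardD1 u : u \in t -> #|(t :\ u)%SET| = m.
  by move=> ut; move: tm; rewrite (cardsD1 u) ut => -[].
have faceD1 u : (t :\ u)%SET \in faces K.
  by apply: faces_down tK _; exact: subsetDl.
have -> : z (exist _ t tP) = cochain_ext z t.
  by apply/esym; exact: cochain_ext_val z (exist _ t tP).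
(* If [v] is in [t], only the term [u = v] survives, as [b] vanishes on faces through [v]; its two
   equal signs cancel. *)
have [vt|vNt] := boolP (v \in t).
  rewrite (bigD1 v) //= big1 ?addr0 => [|u /andP[ut uv]]; last first.
    by rewrite bE ?cardD1 // !inE eq_sym uv vt mulr0.
  rewrite bE ?cardD1 // !inE eqxx /= pos_in_setD1_self finset.setD1K //.
  by rewrite mulrA -exprD addnn -mul2n exprM sqrrN !expr1n mul1r.
(* Otherwise the cone over [t] is a face, and the cocycle condition on it expresses [z] at [t]
   through the facets containing [v]. *)
have vtP : ((v |: t)%SET \in faces K) && (#|(v |: t)%SET| == m.+2).
  by rewrite cardsU1 vNt tm eqxx andbT apex ?setU11 // cardsU1 vNt tm.
have : coboundary z (exist _ (v |: t)%SET vtP) = 0 by rewrite dz ffunE.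
rewrite coboundaryE /= big_setU1 //= pos_in_setU1_self.
rewrite setU1K // => /eqP; rewrite addr_eq0 => /eqP zt.
have sgn2 q : (-1) ^+ q * (-1) ^+ q = 1%R :> int.
  by rewrite -exprD addnn -mul2n exprM sqrrN !expr1n.
transitivity ((-1) ^+ pos_in t v * ((-1) ^+ pos_in t v * cochain_ext z t));
  last by rewrite mulrA sgn2 mul1r.
rewrite zt mulrN big_distrr /= -sumrN.
apply: eq_bigr => u ut.
have uv : u != v by apply: contraNneq vNt => <-.
rewrite bE ?cardD1 // !inE (negbTE vNt) andbF.
have -> : (v |: t :\ u)%SET = ((v |: t) :\ u)%SET.
  apply/finset.setP => w; rewrite !inE.
  by case: (w =P v) => [->|] //=; rewrite eq_sym uv.
have -> : pos_in (v |: t)%SET u = ((v < u) + pos_in t u)%N.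
  by rewrite (pos_in_setD1 u (setU11 v t)) setU1K.
rewrite (pos_in_setD1 v ut) !mulrA -mulNr; congr (_ * _).
(* Exactly one of [u < v] and [v < u] holds, so the two position shifts give a single factor -1,
   which cancels the sign from the cocycle condition. *)
have [vu|uv'] := ltnP v u.
  by rewrite ltnNge ltnW //= !add0n exprS; ring.
have -> : (u < v)%N.
  by rewrite ltn_neqAle uv' andbT; apply: contra_neq uv => /val_inj.
by rewrite /= !add0n exprS; ring.
Qed.

(** Degree [m] means faces with [m.+1] vertices, and coning adds one more. *)
Lemma cone_redcohomology0 (v : 'I_n) (m : nat) :
  (forall t : {set 'I_n}, v \in t -> (#|t| <= m.+2)%N -> t \in faces K) ->
  forall x : redcohomology K m, x = 0.
Proof.
move=> apex x; rewrite -(reprK x); set z := repr x.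
have zI : z \in @is_coboundary n K m.
  apply/asboolP; apply: (cone_cocycle_exact apex).
  by apply/eqP; have := valP z.
move: zI; rewrite -[X in X \in _]subr0 Quotient.idealrBE => /eqP ->.
exact: pi_zeror.
Qed.

End ConeCohomology.

(** * Connectivity of a complex with full skeleton *)

Section FreudenthalHats.
Variable R : realType.

(** By the second hypothesis [A] is a chain for the coordinatewise order, so the coordinate sum [rk]
    is injective on it. By the first, coordinates vary by at most 1, so [rk] takes at most [m.+1]
    values. *)
Lemma card_unit_chain (m M : nat) (y : 'I_m -> R) (A : {set {ffun 'I_m -> 'I_M}}) :
  (forall (a : {ffun 'I_m -> 'I_M}) i, a \in A -> `|y i - (a i)%:R| < 1) ->
  (forall (a : {ffun 'I_m -> 'I_M}) i j, a \in A ->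
     (y i - (a i)%:R) - (y j - (a j)%:R) < 1) ->
  (#|A| <= m.+1)%N.
Proof.
move=> near_y chain; pose rk (a : {ffun 'I_m -> 'I_M}) := (\sum_i a i)%N.
have succ_le (k l : nat) : (k < l)%N -> k%:R + 1 <= l%:R :> R.
  by move=> kl; rewrite natr1 ler_nat.
have close a b i : a \in A -> b \in A -> (b i <= (a i).+1)%N.
  move=> aA bA; rewrite leqNgt; apply/negP => /succ_le.
  have := near_y a i aA; have := near_y b i bA; rewrite !ltr_norml -natr1; lra.
have mono a b : a \in A -> b \in A -> (rk a <= rk b)%N -> forall i, (a i <= b i)%N.
  move=> aA bA ab i; rewrite leqNgt; apply/negP => bai; move: ab.
  apply/negP; rewrite -ltnNge /rk (bigD1 i) //= [ltnRHS](bigD1 i) //=.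
  rewrite -addSn leq_add // leq_sum // => j _.
  rewrite leqNgt; apply/negP => abj.
  have := chain a j i aA; have := chain b i j bA.
  have := succ_le _ _ bai; have := succ_le _ _ abj; lra.
have [->|[a1 a1A]] := set_0Vmem A; first by rewrite cards0.
have [a aA amin] : exists2 a, a \in A & forall b, b \in A -> (rk a <= rk b)%N.
  by exists [arg min_(a < a1 in A) rk a]; case: arg_minnP.
have rk_lt b : b \in A -> (rk b - rk a < m.+1)%N.
  move=> bA; rewrite ltnS leq_subLR /rk.
  rewrite -[X in (_ + X)%N](card_ord m) -sum1_card -big_split /=.
  by apply: leq_sum => i _; rewrite addn1 close.
rewrite -[m.+1]card_ord.
rewrite -(card_in_imset (f := fun b => inord (rk b - rk a) : 'I_m.+1)).
  exact: max_card.
move=> b c bA cA /(congr1 val); rewrite /= !inordK ?rk_lt // => bc.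
have rbc : rk b = rk c.
  by rewrite -(subnKC (amin b bA)) bc subnKC // amin.
by apply/ffunP => i; apply/val_inj/anti_leq; rewrite !mono // rbc.
Qed.

(** Twice the positive part, written with the norm so that continuity is immediate. *)
Definition ramp (u : R) : R := `|u| + u.

Lemma ramp_ge0 u : 0 <= ramp u.
Proof. by rewrite /ramp -lerBlDr sub0r -normrN ler_norm. Qed.

Lemma ramp_gt0 u : 0 < u -> 0 < ramp u.
Proof. by move=> u0; rewrite ltr_wpDl. Qed.

Lemma ramp_neq0 u : ramp u != 0 -> 0 < u.
Proof.
by apply: contra_neqT; rewrite -leNgt => u0; rewrite /ramp ler0_norm ?addNr.
Qed.

Lemma ramp_cvg (T : Type) (F : set_system T) (f : T -> R) (l : R) : Filter F ->
  f x @[x --> F] --> l -> ramp (f x) @[x --> F] --> ramp l.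
Proof. by move=> FF fl; apply: cvgD => //; exact: cvg_norm. Qed.

Variables m N : nat.

Definition grid_coord (x : 'rV[R]_m) (i : 'I_m) : R := N%:R * (x ord0 i + 1).

(* Positive exactly on the open star of the vertex a in Freudenthal's triangulation
   of R^m, here scaled by 1/N and shifted so that the grid points with coordinates
   in [0, 2N+1] cover the cube [-1, 1]^m. *)
Definition hat (a : {ffun 'I_m -> 'I_(2 * N).+2}) (x : 'rV[R]_m) : R :=
  \prod_i (ramp (1 - `|grid_coord x i - (a i)%:R|) *
    \prod_j ramp (1 - ((grid_coord x i - (a i)%:R) -
                       (grid_coord x j - (a j)%:R)))).

Lemma hat_ge0 a x : 0 <= hat a x.
Proof.
by apply: prodr_ge0 => i _; rewrite mulr_ge0 ?ramp_ge0 // prodr_ge0 // => j _;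
  exact: ramp_ge0.
Qed.

Lemma hat_neq0 a x : hat a x != 0 -> forall i,
  `|grid_coord x i - (a i)%:R| < 1 /\
  forall j, (grid_coord x i - (a i)%:R) - (grid_coord x j - (a j)%:R) < 1.
Proof.
move=> /prodf_neq0 ax i; have := ax i isT; rewrite mulf_eq0 negb_or.
move=> /andP[/ramp_neq0 + /prodf_neq0 axi]; rewrite subr_gt0 => ax1; split=> // j.
by have /ramp_neq0 := axi j isT; rewrite subr_gt0.
Qed.

Lemma card_hat_neq0 x : (#|[set a | hat a x != 0%R]%SET| <= m.+1)%N.
Proof.
apply: (card_unit_chain (y := grid_coord x)) => [a i|a i j]; rewrite inE.
  by move=> /hat_neq0/(_ i)[].
by move=> /hat_neq0/(_ i)[_]; apply.
Qed.

(** Rounding the grid coordinates down leaves remainders in [0, 1), which makes every factor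
    positive. *)
Lemma exists_hat_gt0 (x : 'rV[R]_m) :
  (forall i, `|x ord0 i| <= 1) -> exists a, 0 < hat a x.
Proof.
move=> x1.
have gc i : 0 <= grid_coord x i <= (2 * N)%:R.
  have := x1 i; rewrite ler_norml => /andP[xl xu].
  rewrite /grid_coord mulr_ge0 /= -?lerBlDr ?sub0r // natrM mulrC ler_wpM2r //; lra.
pose t i := Num.truncn (grid_coord x i).
have tP i : (t i)%:R <= grid_coord x i < (t i).+1%:R.
  by have /andP[g0 _] := gc i; exact: truncn_itv.
have t_lt i : (t i < (2 * N).+2)%N.
  have /andP[tl _] := tP i; have /andP[_ gu] := gc i.
  by apply: leqW; rewrite ltnS -(ler_nat R) (le_trans tl gu).
exists [ffun i => Ordinal (t_lt i)]; apply: prodr_gt0 => i _.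
have := tP i; rewrite -natr1 => ti.
rewrite mulr_gt0 ?prodr_gt0 //= => [|j _]; apply: ramp_gt0; rewrite !ffunE /=.
  by rewrite subr_gt0 ltr_norml; lra.
by have := tP j; rewrite -natr1; lra.
Qed.

Lemma cvg_prod_fin (T : Type) (F : set_system T) (I : finType) (f : I -> T -> R)
    (l : I -> R) : Filter F ->
  (forall i, f i x @[x --> F] --> l i) ->
  (\prod_i f i x) @[x --> F] --> \prod_i l i.
Proof. by move=> FF fl; apply: cvg_big => //; exact: mul_continuous. Qed.

Lemma cvg_sum_fin (T : Type) (F : set_system T) (I : finType) (f : I -> T -> R)
    (l : I -> R) : Filter F ->
  (forall i, f i x @[x --> F] --> l i) ->
  (\sum_i f i x) @[x --> F] --> \sum_i l i.
Proof. by move=> FF fl; apply: cvg_big => //; exact: add_continuous. Qed.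

Lemma hat_cvg (F : set_system 'rV[R]_m) (x : 'rV[R]_m) a : Filter F ->
  (forall i, y ord0 i @[y --> F] --> x ord0 i) -> hat a y @[y --> F] --> hat a x.
Proof.
move=> FF Fx.
have gcc i : (grid_coord y i - (a i)%:R) @[y --> F] -->
    grid_coord x i - (a i)%:R.
  apply: cvgB; last exact: cvg_cst.
  by apply: cvgM; [exact: cvg_cst|apply: cvgD; [exact: Fx|exact: cvg_cst]].
apply: cvg_prod_fin => i; apply: cvgM.
  by apply: ramp_cvg; apply: cvgB; [exact: cvg_cst|apply: cvg_norm; exact: gcc].
apply: cvg_prod_fin => j; apply: ramp_cvg.
by apply: cvgB; [exact: cvg_cst|apply: cvgB; exact: gcc].
Qed.

End FreudenthalHats.

(** * Barycentric coordinates and simplicial approximation *)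

Section Simplices.
Variables (R : realType) (n : nat).

Definition in_simplex (x : 'rV[R]_n) : Prop :=
  (forall v, 0 <= x ord0 v) /\ \sum_v x ord0 v = 1.

Definition vsupp (x : 'rV[R]_n) : {set 'I_n} := [set v | x ord0 v != 0]%SET.

Lemma in_vsupp (x : 'rV[R]_n) v : (v \in vsupp x) = (x ord0 v != 0).
Proof. by rewrite inE. Qed.

Lemma realizationP (K : complex n) (x : 'rV[R]_n) :
  realization R K x <-> in_simplex x /\ vsupp x \in faces K.
Proof. by split=> [[x0 x1 xK]|[[x0 x1] xK]]. Qed.

Lemma in_simplex_vsupp_neq0 (x : 'rV[R]_n) :
  in_simplex x -> exists v, x ord0 v != 0.
Proof.
move=> [_ x1]; apply: contrapT => x0.
have : \sum_v x ord0 v = 0.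
  apply: big1 => v _; apply/eqP/negPn/negP => xv; apply: x0; by exists v.
by rewrite x1 => /eqP; rewrite oner_eq0.
Qed.

Lemma in_simplex_conv (t : R) (x y : 'rV[R]_n) : 0 <= t <= 1 ->
  in_simplex x -> in_simplex y -> in_simplex (t *: x + (1 - t) *: y).
Proof.
move=> /andP[t0 t1] [x0 x1] [y0 y1]; split=> [v|].
  by rewrite !mxE addr_ge0 // mulr_ge0 // subr_ge0.
under eq_bigr do rewrite !mxE.
by rewrite big_split -!big_distrr /= x1 y1 !mulr1 subrKC.
Qed.

Lemma vsupp_conv (t : R) (x y : 'rV[R]_n) :
  vsupp (t *: x + (1 - t) *: y) \subset vsupp x :|: vsupp y.
Proof.
apply/fintype.subsetP => v; rewrite !inE !mxE -negb_and.
by apply: contra => /andP[/eqP -> /eqP ->]; rewrite !mulr0 addr0.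
Qed.

End Simplices.

Section Barycenter.
Variables (R : realType) (n : nat) (I : finType) (T : Type).
Variables (phi : I -> T -> R) (vx : I -> 'I_n).
Hypothesis phi_ge0 : forall a x, 0 <= phi a x.

(** Where the weights have positive sum, they are normalised to a partition of unity; [vx] assigns a
    vertex of the target simplex to each index. *)
Definition barycenter (x : T) : 'rV[R]_n :=
  (\sum_a phi a x)^-1 *: \sum_a phi a x *: delta_mx ord0 (vx a).

Lemma barycenterE x v : barycenter x ord0 v =
  (\sum_a phi a x)^-1 * \sum_(a | vx a == v) phi a x.
Proof.
rewrite !mxE summxE; congr (_ * _); rewrite [RHS]big_mkcond.
by apply: eq_bigr => a _; rewrite !mxE eqxx /= eq_sym; case: eqP; rewrite ?mulr1 ?mulr0.
Qed.

Lemma barycenter_simplex x : 0 < \sum_a phi a x -> in_simplex (barycenter x).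
Proof.
move=> phi0; split=> [v|].
  by rewrite barycenterE mulr_ge0 ?invr_ge0 ?(ltW phi0) ?sumr_ge0.
under eq_bigr do rewrite barycenterE.
have phiE : \sum_v \sum_(a | vx a == v) phi a x = \sum_a phi a x.
  by rewrite [RHS](partition_big vx xpredT).
by rewrite -big_distrr /= phiE mulVf ?gt_eqF.
Qed.

Lemma vsupp_barycenter x :
  vsupp (barycenter x) \subset vx @: [set a | phi a x != 0%R]%SET.
Proof.
apply/fintype.subsetP => v; rewrite in_vsupp barycenterE mulf_eq0 negb_or.
move=> /andP[_]; apply: contraNT => v_out; rewrite big1 // => a /eqP av.
apply/eqP/negPn/negP => ax; move/negP: v_out; apply.
by apply/imsetP; exists a; rewrite ?inE.
Qed.

Lemma barycenter_cvg (F : set_system T) x : Filter F ->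
  0 < \sum_a phi a x ->
  (forall a, phi a y @[y --> F] --> phi a x) ->
  barycenter y @[y --> F] --> barycenter x.
Proof.
move=> FF phi0 phic; apply: cvgZ.
  apply: cvgV; first by rewrite gt_eqF.
  by apply: cvg_big => //; exact: add_continuous.
apply: cvg_big => // [|a _]; first exact: add_continuous.
by apply: cvgZ; [exact: phic|exact: cvg_cst].
Qed.

End Barycenter.

(** A Lebesgue number for the cover of [A] by the sets where some coordinate of [F] is nonzero. The
    balls may leave [A], since [F] is continuous at points of [A] in the whole space. *)
Lemma lebesgue_number_coord (R : realType) (m n : nat) (A : set 'rV[R]_m)
    (F : 'rV[R]_m -> 'rV[R]_n) : compact A ->
  (forall x, A x -> F y @[y --> x] --> F x) ->
  (forall x, A x -> exists v, F x ord0 v != 0) ->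
  exists2 e : R, 0 < e &
    forall x, A x -> exists v, forall y, ball x e y -> F y ord0 v != 0.
Proof.
move=> cA Fc F0.
have : \forall e \near (0 : R)^'+, A `<=` (fun x =>
    exists v, forall y, ball x e y -> F y ord0 v != 0).
  move/compact_near_coveringP : cA; apply => x Ax.
  have [v Fxv] := F0 x Ax.
  have Fv : (F y ord0 v) @[y --> x] --> F x ord0 v.
    exact: cvg_comp (Fc x Ax) (@coord_continuous R 1 n ord0 v (F x)).
  have : \forall y \near x, F y ord0 v != 0.
    exact: (cvgr_neq0 _ Fv Fxv).
  move=> /nbhs_ballP[r /= r0 Fr].
  (* Half of [r] covers the displacement of the centre, the other half the radius [e]. *)
  exists (ball x (r / 2), [set e : R | 0 < e < r / 2]) => /=.
    split; first by apply: nbhsx_ballx; rewrite divr_gt0.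
    by near=> e; apply/andP; split; near: e;
      [exact: nbhs_right_gt|apply: nbhs_right_lt; rewrite divr_gt0].
  move=> [x' e] /= [xx' /andP[e0 er]]; exists v => y x'y; apply: Fr.
  exact: (ball_split xx' (le_ball (ltW er) x'y)).
move=> near_e.
have [e [e0 He]] : exists e : R, 0 < e /\ A `<=` (fun x =>
    exists v, forall y, ball x e y -> F y ord0 v != 0).
  near (0 : R)^'+ => e; exists e; split; first by near: e; exact: nbhs_right_gt.
  by near: e.
by exists e => // x /He.
Unshelve. all: by end_near. Qed.

(* F itself may have arbitrarily large supports; h is a map with supports of the
   dimension of the domain, joined to F by segments inside the supports of F. *)
Lemma simplicial_approximation (R : realType) (m n : nat) (A : set 'rV[R]_m)
    (F : 'rV[R]_m -> 'rV[R]_n) (v0 : 'I_n) : compact A ->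
  (forall x, A x -> F y @[y --> x] --> F x) ->
  (forall x, A x -> in_simplex (F x)) ->
  exists h : 'rV[R]_m -> 'rV[R]_n,
    (forall x : 'rV[R]_m, (forall i, `|x ord0 i| <= 1) ->
       [/\ h y @[y --> x] --> h x, in_simplex (h x) & (#|vsupp (h x)| <= m.+1)%N]) /\
    (forall x, A x -> vsupp (h x) \subset vsupp (F x)).
Proof.
move=> cA Fc Fs.
have [|e e0 lebF] := lebesgue_number_coord cA Fc.
  by move=> x Ax; exact: in_simplex_vsupp_neq0 (Fs x Ax).
(* Points of one open star differ by less than [2 / N] in each coordinate, hence by less than
   [e]. *)
have [N N0 Ne] : exists2 N : nat, 0 < N%:R :> R & 2 < N%:R * e.
  exists (Num.truncn (2 / e)).+1; first by rewrite ltr0n.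
  have e2 : 0 <= 2 / e by rewrite divr_ge0 // ltW.
  by rewrite -ltr_pdivrMr //; have /andP[] := truncn_itv e2.
have hat_ball a x y : hat (N := N) a x != 0 -> hat a y != 0 -> ball x e y.
  move=> /hat_neq0 ax /hat_neq0 ay; split=> // i j; have -> : i = ord0 by exact: ord1.
  rewrite -ball_normE /= -(ltr_pM2l N0) -{1}(gtr0_norm N0) -normrM mulrBr.
  have [ax1 _] := ax j; have [ay1 _] := ay j; move: ax1 ay1.
  by rewrite /grid_coord !ltr_norml; lra.
(* If the star of [a] meets [A] at [y], it lies in the ball around [y], so the coordinate chosen
   there works on the whole star. Other grid points get the default [v0]. *)
have /boolp.choice[vx vxP] : forall a : {ffun 'I_m -> 'I_(2 * N).+2},
    exists v, forall x, A x -> hat a x != 0 -> F x ord0 v != 0.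
  move=> a; have [[y [Ay ay]]|none] := pselect (exists y, A y /\ hat a y != 0).
    have [v Fv] := lebF y Ay; exists v => x Ax ax; apply: Fv.
    exact: hat_ball ay ax.
  by exists v0 => x Ax ax; case: none; exists x.
exists (barycenter (@hat R m N) vx); split=> [x x1|x Ax].
  have hat0 : 0 < \sum_a hat (N := N) a x.
    have [a ax] := exists_hat_gt0 N x1.
    rewrite (bigD1 a) //= ltr_pwDl // sumr_ge0 // => b _; exact: hat_ge0.
  split.
  - have FF : Filter (nbhs x) := nbhs_filter x.
    apply: (@barycenter_cvg R n _ _ (@hat R m N) vx _ x FF hat0) => a.
    by apply: (@hat_cvg R m N _ x a FF) => i; exact: coord_continuous.
  - by apply: barycenter_simplex => //; exact: hat_ge0.
  apply: leq_trans (subset_leq_card (vsupp_barycenter _ _ _)) _.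
  exact: leq_trans (leq_imset_card _ _) (card_hat_neq0 N x).
apply: fintype.subset_trans (vsupp_barycenter _ _ _) _.
apply/fintype.subsetP => _ /imsetP[a + ->]; rewrite !inE => ax.
exact: vxP.
Qed.

(** * Radial extension from the sphere to the ball *)

Section Radial.
Variables (R : realType) (m : nat).
Implicit Types x y : 'rV[R]_m.

Definition euclid_norm x : R := Num.sqrt (\sum_j x ord0 j ^+ 2).

Lemma sum_sqr_ge0 x : 0 <= \sum_j x ord0 j ^+ 2.
Proof. by apply: sumr_ge0 => j _; exact: sqr_ge0. Qed.

Lemma sum_sqr_cvg x :
  (\sum_j y ord0 j ^+ 2) @[y --> x] --> \sum_j x ord0 j ^+ 2.
Proof.
have FF : Filter (nbhs x) := nbhs_filter x.
apply: (cvg_sum_fin (F := nbhs x)) => j.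
by rewrite expr2; under eq_fun do rewrite expr2; apply: cvgM; exact: coord_continuous.
Qed.

Lemma euclid_norm_cvg x : euclid_norm y @[y --> x] --> euclid_norm x.
Proof. exact: cvg_comp (@sum_sqr_cvg x) (@sqrt_continuous R _). Qed.

Lemma euclid_norm_le1 x : (euclid_norm x <= 1) = (\sum_j x ord0 j ^+ 2 <= 1).
Proof. by rewrite /euclid_norm -{1}(sqrtr1 R) ler_sqrt. Qed.

Lemma coord_le1 x i : \sum_j x ord0 j ^+ 2 <= 1 -> `|x ord0 i| <= 1.
Proof.
move=> x1; rewrite -(ler_sqr (x := `|_|)) ?nnegrE ?ler01 //.
rewrite expr1n real_normK ?num_real //.
apply: le_trans x1; rewrite (bigD1 i) //= lerDl.
by apply: sumr_ge0 => j _; exact: sqr_ge0.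
Qed.

Lemma euclid_norm_normalize x : euclid_norm x != 0 ->
  \sum_j (((euclid_norm x)^-1 *: x) ord0 j) ^+ 2 = 1.
Proof.
move=> x0; under eq_bigr do rewrite mxE exprMn.
by rewrite -big_distrr /= exprVn sqr_sqrtr ?sum_sqr_ge0 // mulVf //
  -(sqr_sqrtr (sum_sqr_ge0 x)) expf_neq0.
Qed.

Lemma annulus_compact :
  compact [set x : 'rV[R]_m | 2^-1 <= euclid_norm x <= 1].
Proof.
have cube : compact [set x : 'rV[R]_m | forall i, `[(-1 : R), 1]%classic (x ord0 i)].
  apply: (@rV_compact _ m (fun=> `[(-1 : R), 1]%classic)) => i.
  exact: segment_compact.
apply: subclosed_compact cube _.
  rewrite (_ : [set _ | _] = euclid_norm @^-1` `[2^-1, 1]%classic).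
    apply: preimage_closed; last exact: interval_closed.
    by move=> x _; exact: euclid_norm_cvg.
  by apply/seteqP; split=> x /=; rewrite in_itv.
move=> x /= /andP[_]; rewrite euclid_norm_le1 => x1 i.
by rewrite in_itv /= -ler_norml coord_le1.
Qed.

End Radial.

(** Normalising maps a neighbourhood of [x] into the sphere, so continuity of [f] within the sphere
    gives unrestricted continuity of the composite. *)
Lemma radial_cvg (R : realType) (i : nat) (T : topologicalType)
    (f : 'rV[R]_i.+1 -> T) (x : 'rV[R]_i.+1) :
  {within sphere R i, continuous f} -> euclid_norm x != 0 ->
  f ((euclid_norm y)^-1 *: y) @[y --> x] --> f ((euclid_norm x)^-1 *: x).
Proof.
move=> /subspace_continuousP fc x0; have FF : Filter (nbhs x) := nbhs_filter x.
have th : ((euclid_norm y)^-1 *: y) @[y --> x] --> (euclid_norm x)^-1 *: x.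
  apply: (@cvgZ R _ _ (nbhs x) FF); last exact: cvg_id.
  by apply: (@cvgV R _ (nbhs x) FF) => //; exact: euclid_norm_cvg.
have fcx := fc _ (euclid_norm_normalize x0 : sphere R i _).
pose th_x (y : 'rV[R]_i.+1) := (euclid_norm y)^-1 *: y.
apply: (@cvg_comp _ _ _ th_x f (nbhs x) _ _ _ fcx) => P PA.
have near_P : \forall y \near x, sphere R i (th_x y) -> P (th_x y).
  exact: (th _ PA).
have near0 : \forall y \near x, euclid_norm y != 0.
  exact: (cvgr_neq0 _ (@euclid_norm_cvg _ _ x) x0).
suff : \forall y \near x, P (th_x y) by [].
apply: filterS2 near_P near0 => y Py y0.
exact: Py (euclid_norm_normalize y0 : sphere R i _).
Qed.

(** The extension is [h] on the inner half ball, where supports have at most [i + 2] vertices. On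
    the annulus it moves along segments inside the face carrying [F x], reaching [f] on the
    sphere. *)
Lemma kconnected_full_skeleton (R : realType) (n k : nat) (K : complex n)
    (v0 : 'I_n) :
  (forall t : {set 'I_n}, (#|t| <= k.+2)%N -> t \in faces K) ->
  kconnected R K k.
Proof.
move=> skel i ik f fc fK.
pose A := [set x : 'rV[R]_i.+1 | 2^-1 <= euclid_norm x <= 1].
pose F (x : 'rV[R]_i.+1) := f ((euclid_norm x)^-1 *: x).
have A0 x : A x -> euclid_norm x != 0.
  by move=> /andP[x2 _]; rewrite gt_eqF // (lt_le_trans _ x2) // invr_gt0.
have FK x : euclid_norm x != 0 -> realization R K (F x).
  by move=> x0; apply: fK; exists ((euclid_norm x)^-1 *: x) => //;
    exact: euclid_norm_normalize.
have Fc x : A x -> F y @[y --> x] --> F x by move=> /A0; exact: radial_cvg.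
have Fs x : A x -> in_simplex (F x).
  by move=> /A0/FK/realizationP[].
have [h [hP hA]] := simplicial_approximation v0 (@annulus_compact R i.+1) Fc Fs.
(* This is 0 up to radius 1/2 and grows linearly to 1 at radius 1. *)
pose alpha (x : 'rV[R]_i.+1) := ramp (2 * euclid_norm x - 1) / 2.
have alpha_small x : euclid_norm x <= 2^-1 -> alpha x = 0.
  move=> x2; rewrite /alpha /ramp ler0_norm ?addNr ?mul0r //; lra.
have alpha_large x : 2^-1 <= euclid_norm x -> alpha x = 2 * euclid_norm x - 1.
  move=> x2; rewrite /alpha /ramp ger0_norm; lra.
have alpha_cvg x : alpha y @[y --> x] --> alpha x.
  have FF : Filter (nbhs x) := nbhs_filter x.
  apply: (@cvgM R _ (nbhs x) FF); last exact: cvg_cst.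
  apply: ramp_cvg; apply: (@cvgB R _ _ (nbhs x) FF); last exact: cvg_cst.
  by apply: (@cvgM R _ (nbhs x) FF); [exact: cvg_cst|exact: euclid_norm_cvg].
have alphaF_cvg x : alpha y *: F y @[y --> x] --> alpha x *: F x.
  have [x0|x0] := eqVneq (euclid_norm x) 0; last first.
    by apply: (@cvgZ R _ _ (nbhs x)); [exact: alpha_cvg|exact: radial_cvg].
  (* [F] need not be continuous at the origin, but [alpha] vanishes on a neighbourhood of it. *)
  have near0 : \forall y \near x, 0 = alpha y *: F y.
    have : \forall y \near x, euclid_norm y < 2^-1.
      apply: (cvgr_lt _ (@euclid_norm_cvg _ _ x)).
      by rewrite x0 invr_gt0.
    by apply: filterS => y /ltW/alpha_small ->; rewrite scale0r.
  rewrite alpha_small ?x0 ?invr_ge0 // scale0r.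
  by apply: cvg_trans (near_eq_cvg near0) _; exact: cvg_cst.
exists (fun x => alpha x *: F x + (1 - alpha x) *: h x).
have ball1 x : cball R i.+1 x -> euclid_norm x <= 1 by rewrite euclid_norm_le1.
split.
- apply: continuous_in_subspaceT => x /set_mem xB.
  have [hc _ _] := hP x (fun j => coord_le1 j xB).
  have FF : Filter (nbhs x) := nbhs_filter x.
  apply: (@cvgD R _ _ (nbhs x) FF); first exact: alphaF_cvg.
  apply: (@cvgZ R _ _ (nbhs x) FF) => //.
  by apply: (@cvgB R _ _ (nbhs x) FF); [exact: cvg_cst|exact: alpha_cvg].
- move=> _ [x xB <-]; apply/realizationP.
  have [_ hs hcard] := hP x (fun j => coord_le1 j xB).
  have [x2|x2] := leP (euclid_norm x) 2^-1.
    rewrite alpha_small // scale0r add0r subr0 scale1r; split=> //.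
    by apply: skel; apply: leq_trans hcard _; rewrite !ltnS.
  have Ax : A x by rewrite /A /= (ltW x2) ball1.
  have /realizationP[Fx FxK] := FK x (A0 x Ax).
  split.
    apply: in_simplex_conv => //; rewrite alpha_large ?(ltW x2) //.
    have := ball1 x xB; lra.
  apply: faces_down FxK _; apply: fintype.subset_trans (vsupp_conv _ _ _) _.
  by rewrite finset.subUset fintype.subxx hA.
- move=> x xS; have x1 : euclid_norm x = 1.
    by rewrite /euclid_norm (xS : \sum_j _ = 1) sqrtr1.
  rewrite alpha_large ?x1; last by lra.
  rewrite (_ : 2 * 1 - 1 = 1 :> R); last by lra.
  by rewrite subrr scale0r addr0 scale1r /F x1 invr1 scale1r.
Qed.

Theorem theorem1p9 (R : realType) (k s : nat) (p : nat -> R)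
  (hs : (1 <= s)%N) (hk : (s <= k)%N)
  (hp : forall n : nat, 0 < p n < 1)
  (hmono : {homo p : m n / (m <= n)%N >-> m <= n} \/
           {homo p : m n / (m <= n)%N >-> n <= m})
  (hsmall : (fun n : nat =>
               ('C(n, k + 2))%:R * (1 - p n ^+ (k + 2)) ^+ (n - k - 2) : R^o)
            =o_\oo (fun n : nat => n%:R ^+ s : R^o)) :
  almost_always p (fun n (G : sgraph n) =>
    kconnected R (nbhd_complex G) (k - s)) /\
  almost_always p (fun n (G : sgraph n) =>
    forall x : redcohomology (nbhd_complex G) (k - s + 1), x = 0).
Proof.
have p01 n : 0 <= p n <= 1 by have /andP[/ltW -> /ltW ->] := hp n.
(* With [b = k - s + 3] and [c = k + 2] the exponent [(c - b).+1] is [s]; [b <= c] holds because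
   [1 <= s]. *)
have bc : ((k - s + 1).+2 <= k + 2)%N by lia.
have apex := almost_always_apex p01 bc.
rewrite (_ : (k + 2 - (k - s + 1).+2).+1 = s) in apex; last by lia.
rewrite (_ : (fun n => _) = (fun n : nat =>
  ('C(n, k + 2))%:R * (1 - p n ^+ (k + 2)) ^+ (n - k - 2) : R^o)) in apex; last first.
  by apply/funext => n; rewrite subnDA.
have {}apex := apex hsmall.
split; apply: almost_always_imply p01 _ _ _ apex => n G [v vG].
  (* A set of at most [k - s + 2] vertices becomes a face after adding [v], hence is itself a
     face. *)
  apply: (kconnected_full_skeleton v) => t tk.
  apply: (@faces_down _ (nbhd_complex G) (v |: t)%SET); last exact: finset.subsetUr.
  apply: vG; first exact: setU11.
  by rewrite cardsU1 (leq_trans (leq_add (leq_b1 _) tk)) // addn1.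
exact: (@cone_redcohomology0 _ (nbhd_complex G) v _ vG).
Qed.
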